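(* Let $b\ge2$ be an integer and $\beta>0$. Let $v_0\in\mathcal V$ and suppose that $\theta:=e^{-2\pi^2/\beta}$ obeys $b\theta=1$. Let $\{a_0(n)\}_{n\in\mathbb Z}$ be the positive $\ell^1(\mathbb Z)$-sequence with $e^{-v_0(z)}=\sum_{n\in\mathbb Z}a_0(n)e^{2\pi {\rm i}nz}$, and denote $c_0:=\sup_{n\ge0}\frac{a_0(n+1)}{a_0(n)}$. Let $v_1,v_2,\dots$ be defined recursively from $v_0$ by $e^{-v_{k+1}(z)}:=E\bigl(e^{-bv_k(z+\zeta)}\bigr)$ with $\zeta$ distributed as $\mathcal N(0,1/\beta)$. Then there exists $\gamma>0$ such that $$\sup_{z,z'\in[0,1]}\bigl|v_{k+1}(z)-bv_k(z')\bigr|\le8[1+\gamma k]^{-1/2}bc_0$$ holds for all $k\in\mathbb N$ satisfying $[1+\gamma k]^{-1/2}bc_0\le1/8$.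
   Context: $\mathcal V$ denotes the set of even functions $v\colon\mathbb R\to\mathbb R$ for which there exists a positive sequence $\{a(n)\}_{n\in\mathbb Z}\in\ell^1(\mathbb Z)$ such that $e^{-v(z)}=\sum_{n\in\mathbb Z}a(n)e^{2\pi{\rm i}nz}$ for all $z\in\mathbb R$ and $\sup_{n\ge0}\frac{a(n+1)}{a(n)}<\infty$. *)

(* Defs.v *)
From HB Require Import structures.
From mathcomp Require Import all_boot all_order all_algebra.
From mathcomp Require Import complex.
From mathcomp Require Import all_classical all_reals all_analysis.

Set Implicit Arguments.
Unset Strict Implicit.
Unset Printing Implicit Defensive.

Import Order.TTheory GRing.Theory Num.Theory.
Import numFieldNormedType.Exports.

Local Open Scope classical_set_scope.
Local Open Scope complex_scope.
Local Open Scope ring_scope.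

(* [expi t] is e^{i t}; the complex numbers R[i] come with no exponential. *)
Definition expi (R : realType) (t : R) : R[i] := cos t +i* sin t.

(* The partial sum of a(n) e^{2 pi i n z} over the integers -N <= n <= N. *)
Definition fourier_partial_sum (R : realType) (a : int -> R) (z : R) (N : nat)
    : R[i]^o :=
  \sum_(j < N.*2.+1)
    let n := (nat_of_ord j)%:Z - N%:Z in
    (a n)%:C * expi (2 * pi * n%:~R * z).

(* [a] is a positive l^1(Z) sequence with e^{-v(z)} = sum_n a(n) e^{2 pi i n z}.
   The series converges absolutely, so taking the limit of the symmetric
   partial sums, in R[i], gives the sum over Z. *)
Definition fourier_repr (R : realType) (v : R -> R) (a : int -> R) : Prop :=
  [/\ forall n : int, 0 < a n,
      summable [set: int] (fun n => (a n)%:E) &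
      forall z : R,
        fourier_partial_sum a z @ \oo --> ((expR (- v z))%:C : R[i]^o)].

(* Extended-real valued: the supremum may be infinite. *)
Definition sup_ratio (R : realType) (a : int -> R) : \bar R :=
  ereal_sup (range (fun n : nat => (a n.+1%:Z / a n%:Z)%:E)).

Definition calV (R : realType) (v : R -> R) : Prop :=
  (forall z : R, v (- z) = v z) /\
  exists2 a : int -> R, fourier_repr v a & (sup_ratio a < +oo)%E.

(* Mean 0 and variance 1/beta; [normal_prob] takes the standard deviation.
   The laws are compared on measurable sets only, because measures are
   functions of arbitrary sets, with no meaning on the nonmeasurable ones. *)
Definition centered_normal (d : measure_display) (T : measurableType d)
    (R : realType) (P : probability T R) (zeta : {RV P >-> R}) (beta : R)
    : Prop :=
  forall A : set R, measurable A ->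
    distribution P zeta A = normal_prob 0 (Num.sqrt beta^-1) A.

(* e^{-v_{k+1}(z)} := E(e^{-b v_k(z + zeta)}), solved for v_{k+1}. *)
Fixpoint renorm_potential (d : measure_display) (T : measurableType d)
    (R : realType) (P : probability T R) (zeta : {RV P >-> R}) (b : nat)
    (v0 : R -> R) (k : nat) : R -> R :=
  if k is k'.+1 then
    let vk := renorm_potential zeta b v0 k' in
    fun z => - ln (fine ('E_P[(fun w => expR (- (b%:R * vk (z + zeta w))))%R])%E)
  else v0.

(* Main.v *)
Require Import Defs.
From HB Require Import structures.
From mathcomp Require Import all_boot all_order all_algebra.
From mathcomp Require Import complex ring lra zify.
From mathcomp Require Import all_classical all_reals all_analysis.
From mathcomp Require Import measurable_realfun.

Set Implicit Arguments.
Unset Strict Implicit.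
Unset Printing Implicit Defensive.

Import Order.TTheory GRing.Theory Num.Theory.
Import numFieldNormedType.Exports.

Local Open Scope classical_set_scope.
Local Open Scope ring_scope.

(* For an even sequence [a] let [c = sup_(n >= 0) a(n+1) / a(n)]. The step
   [v_k |-> v_(k+1)] replaces [a] by [theta^(n^2) (a * ... * a)(n)] ([b] factors).
   Convolution adds the ratio bounds and [theta^(2n+1) <= theta = 1/b], so [c]
   does not increase. At [n >= 1] it even drops by [theta^2]; at [n = 0],
   splitting [(a * a')(1)] and [(a * a')(0)] around the central term shows that
   [c] becomes at most [c (1 - delta c^2)]. Hence [c_k <= c_0 (1 + gamma k)^(-1/2)].
   When [b c_k <= 1/8] the Fourier coefficients decay geometrically, so that both
   [e^(-v_(k+1))] and [e^(-b v_k)] are close to the zeroth coefficient of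
   [e^(-b v_k)].

   Truncating [a_0] to [|n| <= N] preserves the ratio bound, so the recursion on
   coefficients only concerns trigonometric polynomials, with constants
   independent of [N]; the resulting inequalities are closed and pass to the
   limit by dominated convergence. That [a_0] is even and [c_0] finite follows from
   uniqueness of Fourier coefficients, which is read off Gaussian averages of
   [e^(-2 pi i m t z) sum_n d(n) e^(2 pi i n t z)] as [t] grows. *)

(** * The characteristic function of a centered normal variable *)

Lemma measurable_cos (R : realType) : measurable_fun setT (@cos R).
Proof. by apply: continuous_measurable_fun; exact: continuous_cos. Qed.

Lemma measurable_sin (R : realType) : measurable_fun setT (@sin R).
Proof. by apply: continuous_measurable_fun; exact: continuous_sin. Qed.

(** Both [normal_pdf] and the Radon-Nikodym derivative integrate to [normal_prob] on every
    measurable set, so they agree almost everywhere. *)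
Lemma integral_normal_prob (R : realType) (m s : R) (f : R -> \bar R) :
  (normal_prob m s).-integrable [set: R] f ->
  (\int[normal_prob m s]_x f x =
   \int[lebesgue_measure]_x (f x * (normal_pdf m s x)%:E))%E.
Proof.
move=> fi; have ns := normal_prob_dominates m s.
rewrite -(Radon_Nikodym_change_of_variables ns)//.
have mpdf : measurable_fun setT (EFin \o normal_pdf m s).
  by apply/measurable_EFinP; exact: measurable_normal_pdf.
have mf := measurable_int _ fi.
apply: ae_eq_integral => //.
- exact: emeasurable_funM.
- exact: emeasurable_funM.
have h : ae_eq lebesgue_measure setT
    (Radon_Nikodym (charge_of_finite_measure (normal_prob m s)) lebesgue_measure)
    (fun x => (normal_pdf m s x)%:E).
  apply: integral_ae_eq => //; first exact: Radon_Nikodym_integrable.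
  move=> E _ mE.
  by rewrite -Radon_Nikodym_integral.
by apply: filterS h => x hx _; rewrite hx.
Qed.

(** The fundamental theorem of calculus on the intervals [A n], which exhaust the line, and
    dominated convergence; decay of [F] along the integers is therefore enough. *)
Lemma integral_derive_eq0 (R : realType) (F f : R -> R) :
  (forall x : R, is_derive x (1 : R) F (f x)) -> continuous f ->
  lebesgue_measure.-integrable setT (EFin \o f) ->
  F n%:R @[n --> \oo] --> 0 -> F (- n%:R) @[n --> \oo] --> 0 ->
  (\int[lebesgue_measure]_x (f x)%:E = 0)%E.
Proof.
move=> dF cf fi F0 F0'.
(* The shift to [n.+1] keeps every interval nondegenerate. *)
pose A (n : nat) := `[(- n.+1%:R : R), n.+1%:R]%classic.
pose g n := (EFin \o f) \_ (A n).
have mf := measurable_int _ fi.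
have mA n : measurable (A n) by exact: measurable_itv.
have [|||||_ _] := @dominated_convergence _ _ _ lebesgue_measure setT measurableT
    g (EFin \o f) (abse \o EFin \o f).
- by move=> n; apply/(measurable_restrictT _ (mA n))/measurable_funTS.
- exact: mf.
- apply: aeW => x _; apply: cvg_near_cst; near=> n.
  rewrite /g patchE mem_set// /A /= in_itv/= -ler_norml.
  apply: (@le_trans _ _ n%:R); last by rewrite ler_nat.
  by near: n; exact: nbhs_infty_ger.
- by apply: integrable_abse.
- apply: aeW => x n _; rewrite /g patchE; case: ifPn => //= _.
  by rewrite normr0 lee_fin.
move=> /cvg_lim <-//; apply/cvg_lim => //=.
rewrite [X in X @ _](_ : _ = (fun n : nat => (F n.+1%:R - F (- n.+1%:R))%:E)).
  apply: cvg_EFin; first by near=> n.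
  rewrite -[X in _ --> X](subr0 0); apply: cvgB.
    by rewrite (cvg_shiftS (fun n => F n%:R)).
  by rewrite (cvg_shiftS (fun n => F (- n%:R))).
apply/funext => n /=; rewrite -[LHS]integral_mkcond.
have cF : continuous F.
  by move=> x; apply: differentiable_continuous; apply/derivable1_diffP.
rewrite EFinB; apply: continuous_FTC2.
- by rewrite -subr_gt0 opprK -natrD ltr0n.
- exact: continuous_subspaceT.
- split => [x _||]; first by have [] := dF x.
  + by apply: cvg_at_right_filter; exact: cF.
  + by apply: cvg_at_left_filter; exact: cF.
- by move=> x _; rewrite derive1E; have [] := dF x.
Unshelve. all: by end_near.
Qed.

(** Doubling the standard deviation absorbs the factor [|x|]: with [u = x / s] the claim is
    [|u| <= e^(3 u^2 / 8)], and [(|u| - 2)^2 >= 0] gives [|u| <= 1 + u^2 / 4]. *)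
Lemma normal_pdf_mulr_le (R : realType) (s x : R) : s != 0 ->
  `|x| * normal_pdf 0 s x <=
  `|s| * normal_peak s / normal_peak (2 * s) * normal_pdf 0 (2 * s) x.
Proof.
move=> s0; have s20 : 2 * s != 0 by rewrite mulf_neq0.
have p0 := normal_peak_gt0 s20; have ps0 := normal_peak_gt0 s0.
rewrite !normal_pdfE// /normal_fun !subr0 [leRHS]mulrA divfK ?gt_eqF//.
rewrite mulrCA (mulrC `|s|) -[leRHS]mulrA ler_pM2l//.
set u := x / s.
have -> : x = u * s by rewrite /u divfK.
have -> : - (u * s) ^+ 2 / (s ^+ 2 *+ 2) = - u ^+ 2 / 2.
  by rewrite exprMn -mulr_natr; field.
have -> : - (u * s) ^+ 2 / ((2 * s) ^+ 2 *+ 2) = - u ^+ 2 / 8.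
  by rewrite !exprMn -mulr_natr; field.
rewrite normrM mulrAC mulrC ler_wpM2l// -ler_pdivlMr ?expR_gt0// -expRN -expRD.
apply: le_trans (expR_ge1Dx _).
have : 0 <= (`|u| - 2) ^+ 2 by exact: sqr_ge0.
have := sqr_ge0 `|u|.
rewrite -(real_normK (num_real u)); move: (`|u|) => w; nra.
Qed.

Lemma is_derive_normal_pdf (R : realType) (s x : R) : s != 0 ->
  is_derive x (1 : R) (normal_pdf 0 s) (- x / s ^+ 2 * normal_pdf 0 s x).
Proof.
move=> s0; rewrite normal_pdfE//.
rewrite /normal_fun; apply: is_derive_eq; rewrite !(subr0, scaler1, scaler0) /=.
rewrite /GRing.scale /= -mulr_natr; field.
by rewrite s0.
Qed.

(** As a function of [t] the integral [h] solves [h' = - s^2 t h], so [h t * e^(s^2 t^2 / 2)] is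
    constant and equals [h 0 = cos c]. *)
Lemma integral_cos_normal_pdf (R : realType) (s c t : R) : s != 0 ->
  (\int[lebesgue_measure]_x (cos (c + t * x) * normal_pdf 0 s x)%:E =
   (cos c * expR (- (s ^+ 2 * t ^+ 2 / 2)))%:E)%E.
Proof.
move=> s0.
pose g := normal_pdf 0 s : R -> R.
have g0 x : 0 <= g x by exact: normal_pdf_ge0.
have cg : continuous g by exact: continuous_normal_pdf.
have ig : lebesgue_measure.-integrable setT (EFin \o g).
  exact: integrable_normal_pdf.
have mg : measurable_fun setT g by exact: measurable_normal_pdf.
have ixg : lebesgue_measure.-integrable setT (EFin \o (fun x => `|x| * g x)).
  have s20 : 2 * s != 0 by rewrite mulf_neq0.
  have ig2 : lebesgue_measure.-integrable setT (EFin \o (fun x =>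
      `|s| * normal_peak s / normal_peak (2 * s) * normal_pdf 0 (2 * s) x)).
    rewrite (_ : EFin \o _ = (fun x : R =>
      (`|s| * normal_peak s / normal_peak (2 * s))%:E *
        (normal_pdf 0 (2 * s) x)%:E)%E) //.
    by apply: integrableZl => //; exact: integrable_normal_pdf.
  apply: (le_integrable _ _ _ ig2) => //.
    by apply/measurable_EFinP/measurable_funM => //; exact: measurableT_comp.
  move=> x _; rewrite /= lee_fin ger0_norm ?mulr_ge0//.
  by apply: le_trans (normal_pdf_mulr_le _ _) (ler_norm _).
have mlin c' t' : measurable_fun setT (fun x : R => c' + t' * x).
  by apply: measurable_funD => //; exact: measurable_funM.
have icos c' t' : lebesgue_measure.-integrable setT
    (EFin \o (fun x => cos (c' + t' * x) * g x)).
  apply: (le_integrable _ _ _ ig) => //.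
    apply/measurable_EFinP/measurable_funM => //.
    exact: (measurableT_comp (@measurable_cos R) (mlin _ _)).
  by move=> x _; rewrite /= lee_fin normrM ler_piMl// cos_max.
have isin t' : lebesgue_measure.-integrable setT
    (EFin \o (fun x => - x * sin (c + t' * x) * g x)).
  apply: (le_integrable _ _ _ ixg) => //.
    apply/measurable_EFinP/measurable_funM => //; apply/measurable_funM => //.
    by exact: (measurableT_comp (@measurable_sin R) (mlin _ _)).
  move=> x _; rewrite /= lee_fin !normrM normr_id normrN ler_wpM2r//.
  by rewrite ler_piMr// sin_max.
pose h t' := (\int[lebesgue_measure]_(x in setT) (cos (c + t' * x) * g x))%R.
(* Gaussian integration by parts: [F] vanishes at infinity, so its derivative, a combination of the
   two integrands, integrates to zero. *)
have stein t' : (\int[lebesgue_measure]_(x in setT) (- x * sin (c + t' * x) * g x) =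
    - (s ^+ 2 * t') * h t')%R.
  pose F x := sin (c + t' * x) * g x.
  have [K gK] : exists K, forall x, `|x| * `|F x| <= K.
    exists (`|s| * normal_peak s / normal_peak (2 * s) * normal_peak (2 * s)) => x.
    apply: (@le_trans _ _ (`|x| * g x)).
      by rewrite ler_wpM2l// normrM (ger0_norm (g0 x)) ler_piMl// sin_max.
    apply: le_trans (normal_pdf_mulr_le _ s0) _.
    rewrite ler_wpM2l// ?normal_pdf_ub ?mulf_neq0//.
    by rewrite !mulr_ge0 ?invr_ge0 ?normal_peak_ge0.
  have F0 (e : R) : `|e| = 1 -> F (e * n%:R) @[n --> \oo] --> 0.
    move=> e1; rewrite -(cvg_shiftS (fun n => F (e * n%:R))).
    apply: norm_cvg0.
    apply: (@squeeze_cvgr _ _ _ _ (cst 0) (fun n => K * harmonic n)).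
    - near=> n; rewrite normr_ge0/= /harmonic ler_pdivlMr ?ltr0n// mulrC.
      by have := gK (e * n.+1%:R); rewrite normrM e1 mul1r normr_nat.
    - exact: cvg_cst.
    - by rewrite -(mulr0 K); apply: cvgMr; exact: cvg_harmonic.
  have dF x : is_derive x (1 : R) F
      (t' * (cos (c + t' * x) * g x) + (s ^+ 2)^-1 * (- x * sin (c + t' * x) * g x)).
    have dg := is_derive_normal_pdf x s0.
    by rewrite /F /g; apply: is_derive_eq; rewrite /GRing.scale /=; field.
  have if1 : lebesgue_measure.-integrable setT
      (EFin \o (fun x => t' * (cos (c + t' * x) * g x))).
    by have := integrableZl measurableT t' (icos c t').
  have if2 : lebesgue_measure.-integrable setT
      (EFin \o (fun x => (s ^+ 2)^-1 * (- x * sin (c + t' * x) * g x))).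
    by have := integrableZl measurableT (s ^+ 2)^-1 (isin t').
  have cF : continuous (fun x => t' * (cos (c + t' * x) * g x) +
      (s ^+ 2)^-1 * (- x * sin (c + t' * x) * g x)).
    have clin : continuous (fun x : R => c + t' * x).
      by move=> x; apply: cvgD; [exact: cvg_cst|apply: cvgMr; exact: cvg_id].
    move=> x; apply: cvgD; apply: cvgMr; apply: cvgM; try exact: cg.
      by apply: (cvg_comp _ (@cos R) (clin x)); exact: continuous_cos.
    apply: cvgM; first by apply: cvgN; exact: cvg_id.
    by apply: (cvg_comp _ (@sin R) (clin x)); exact: continuous_sin.
  have iD := integrableD measurableT if1 if2.
  have Fp : F n%:R @[n --> \oo] --> 0.
    by have := F0 1 (normr1 _); under eq_fun do rewrite mul1r.
  have Fm : F (- n%:R) @[n --> \oo] --> 0.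
    by have := F0 (-1) (normrN1 _); under eq_fun do rewrite mulN1r.
  have := integral_derive_eq0 dF cF iD Fp Fm => /(congr1 fine).
  rewrite -[LHS]/(Rintegral _ _ _) RintegralD// RintegralZl// RintegralZl// -/(h t').
  move=> /= H; rewrite -[LHS](mulVKf (_ : s ^+ 2 != 0)) ?sqrf_eq0//.
  rewrite [X in _ * X](_ : _ = - (t' * h t')); first by ring.
  by apply/eqP; rewrite -addr_eq0 addrC; apply/eqP.
(* Differentiation under the integral, dominated by [|y| * g y] whatever the parameter; [stein] then
   expresses the derivative through [h] itself. *)
have dh t' : is_derive t' (1 : R) h (- (s ^+ 2 * t') * h t').
  pose f t x := cos (c + t * x) * g x.
  have df (r x : R) : is_derive r (1 : R) (f^~ x) (- x * sin (c + r * x) * g x).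
    by rewrite /f; apply: is_derive_eq; rewrite /GRing.scale /=; ring.
  have d1f x r : partial1of2 f r x = - x * sin (c + r * x) * g x.
    by rewrite partial1of2E; have [] := df r x.
  have It : `](t' - 1), (t' + 1)[%classic t'.
    by rewrite /= in_itv/= ltrDl ltr01 ltrBlDr ltrDl ltr01.
  have h1 : forall x, `](t' - 1), (t' + 1)[%classic x ->
      lebesgue_measure.-integrable setT (EFin \o f x).
    by move=> x _; exact: icos.
  have h2 : forall x y, `](t' - 1), (t' + 1)[%classic x -> setT y ->
      derivable (f ^~ y) x 1.
    by move=> x y _ _; have [] := df x y.
  have h3 y : 0 <= `|y| * g y by rewrite mulr_ge0.
  have h4 : forall x y, `](t' - 1), (t' + 1)[%classic x -> setT y ->
      `|partial1of2 f x y| <= `|y| * g y.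
    move=> x y _ _; rewrite d1f !normrM normrN (ger0_norm (g0 _)).
    by rewrite ler_wpM2r// ler_piMr// sin_max.
  apply: DeriveDef.
    exact: (derivable_under_integral measurableT It h1 h2 h3 ixg h4).
  rewrite -derive1E.
  rewrite (differentiation_under_integral measurableT It h1 h2 h3 ixg h4).
  by rewrite -stein; apply: eq_Rintegral => x _; rewrite d1f.
have hE : h t * expR (s ^+ 2 * t ^+ 2 / 2) = h 0 * expR (s ^+ 2 * 0 ^+ 2 / 2).
  pose k t := h t * expR (s ^+ 2 * t ^+ 2 / 2).
  apply: (@is_derive_0_is_cst _ k) => x; rewrite /k.
  have := dh x => {}dh.
  by apply: is_derive_eq; rewrite /GRing.scale /=; field.
have h0 : h 0 = cos c.
  rewrite /h /Rintegral.
  rewrite (_ : (\int[_]_(x in _) _)%E =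
      (\int[lebesgue_measure]_x ((cos c)%:E * (g x)%:E)))%E.
    rewrite integralZl//.
    by rewrite integral_normal_pdf mule1.
  by apply: eq_integral => x _; rewrite mul0r addr0.
rewrite -[LHS]fineK; last first.
  exact: (integrable_fin_num measurableT (icos c t)).
congr EFin.
move: hE; rewrite expr0n/= mulr0 mul0r expR0 mulr1 h0 => <-.
rewrite expRN mulfK ?gt_eqF ?expR_gt0//.
Unshelve. all: by end_near.
Qed.

Lemma integral_cos_centered_normal (d : measure_display) (T : measurableType d)
    (R : realType) (P : probability T R) (zeta : {RV P >-> R}) (beta c t : R) :
  0 < beta -> centered_normal zeta beta ->
  (\int[P]_w (cos (c + t * zeta w))%:E =
   (cos c * expR (- (t ^+ 2 / (2 * beta))))%:E)%E.
Proof.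
move=> beta0 hz; set s := Num.sqrt beta^-1.
have s0 : s != 0 by rewrite gt_eqF// sqrtr_gt0 invr_gt0.
have s2 : s ^+ 2 = beta^-1 by rewrite sqr_sqrtr// invr_ge0 ltW.
pose f (x : R) := (cos (c + t * x))%:E.
have mcos : measurable_fun setT (fun x : R => cos (c + t * x)).
  apply: (measurableT_comp (@measurable_cos R)).
  by apply: measurable_funD => //; exact: measurable_funM.
have mf : measurable_fun [set: R] f by exact/measurable_EFinP.
have fle x : (`|f x| <= 1)%E by rewrite lee_fin cos_max.
have fi d' (T' : measurableType d') (Q : probability T' R) (g : T' -> R) :
    measurable_fun setT g -> Q.-integrable setT (f \o g).
  move=> mg; apply: (@le_integrable _ _ _ _ _ _ _ (cst 1%E)) => //.
  - exact: measurableT_comp mf mg.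
  - by move=> x _; rewrite /= normr1 fle.
  - exact: finite_measure_integrable_cst.
rewrite -[LHS](integral_distribution mf); last exact: fi.
(* The pushforward along the identity regards [normal_prob] as a measure on the space that carries
   the law of [zeta]. *)
pose idR : measurableTypeR R -> R := idfun.
have mid : measurable_fun setT idR by exact: measurable_id.
transitivity (\int[pushforward (normal_prob 0 s) idR]_x f x)%E.
  by apply: eq_measure_integral => A mA _; exact: hz.
rewrite integral_pushforward//; last exact: (fi _ _ (normal_prob 0 s) idR mid).
rewrite integral_normal_prob; last first.
  exact: (fi _ _ (normal_prob 0 s) idR mid).
rewrite [LHS](_ : _ =
  \int[lebesgue_measure]_x (cos (c + t * x) * normal_pdf 0 s x)%:E)%E //.
rewrite integral_cos_normal_pdf// s2; congr (_ * expR (- _))%:E.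
by field; rewrite gt_eqF.
Qed.

(** * Ratio bounds for convolutions *)

(* An even trigonometric polynomial [sum_n a(n) e^(2 pi i n z)] of degree [M] is
   encoded by the polynomial with coefficients [p`_(M + n) = a(n)]. *)
Definition palindromic (R : realType) (p : {poly R}) (M : nat) : Prop :=
  (size p <= M.*2.+1)%N /\ forall i, (i <= M.*2)%N -> p`_(M.*2 - i) = p`_i.

(** Multiplied out, so that it also makes sense where coefficients vanish, as they do beyond index
    [2 * M]. *)
Definition ratio_le (R : realType) (p : {poly R}) (M : nat) (c : R) : Prop :=
  forall n, p`_(M + n).+1 <= c * p`_(M + n).

(** The index set is a rectangle independent of [i], so that both variables can be reversed or
    exchanged separately. *)
Lemma coefM_window (R : comNzRingType) (p q : {poly R}) (m l i : nat) :
  (size p <= m)%N -> (size q <= l)%N ->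
  (p * q)`_i = \sum_(j < m) \sum_(k < l) (p`_j * q`_k) *+ (j + k == i)%N.
Proof.
have poly_window (r : {poly R}) s : (size r <= s)%N -> r = \poly_(j < s) r`_j.
  move=> rs; apply/polyP => j; rewrite coef_poly; case: ltnP => // sj.
  by rewrite nth_default// (leq_trans rs).
move=> /poly_window pm /poly_window ql.
rewrite [in LHS]pm [in LHS]ql !poly_def big_distrlr /= coef_sum.
apply: eq_bigr => j _; rewrite coef_sum; apply: eq_bigr => k _.
by rewrite -scalerAl -scalerAr scalerA -exprD coefZ coefXn mulr_natr eq_sym.
Qed.

Lemma palindromicM (R : realType) (p q : {poly R}) (M L : nat) :
  palindromic p M -> palindromic q L -> palindromic (p * q) (M + L).
Proof.
move=> [sp pp] [sq pq]; split.
  apply: leq_trans (size_polyMleq _ _) _.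
  by move: sp sq; rewrite -!addnn; lia.
move=> i iML; rewrite !(coefM_window _ sp sq).
rewrite (reindex_inj rev_ord_inj) /=; apply: eq_bigr => j _.
rewrite (reindex_inj rev_ord_inj) /=; apply: eq_bigr => k _.
rewrite !subSS pp ?pq; [|by rewrite -ltnS..].
congr (_ *+ nat_of_bool _); move: (ltn_ord j) (ltn_ord k) iML => jM kL iML.
by apply/eqP/eqP; lia.
Qed.

Lemma palindromicX (R : realType) (p : {poly R}) (M b : nat) :
  palindromic p M -> palindromic (p ^+ b) (b * M).
Proof.
move=> pp; elim: b => [|b IH]; last by rewrite exprS mulSn; exact: palindromicM.
by split=> [|i]; [rewrite size_poly1|rewrite leqn0 => /eqP->].
Qed.

Lemma coefM_ge0 (R : realType) (p q : {poly R}) :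
  (forall i, 0 <= p`_i) -> (forall i, 0 <= q`_i) -> forall i, 0 <= (p * q)`_i.
Proof.
by move=> p0 q0 i; rewrite coefM sumr_ge0// => j _; rewrite mulr_ge0.
Qed.

Lemma coefX_ge0 (R : realType) (p : {poly R}) b :
  (forall i, 0 <= p`_i) -> forall i, 0 <= (p ^+ b)`_i.
Proof.
move=> p0; elim: b => [|b IH] i; first by rewrite coef1 ler0n.
by rewrite exprS; exact: coefM_ge0.
Qed.

(** Split the coefficient of index [m + 1] at [j = M]. For [j > M] the ratio bound lowers the index
    of [p]; for [j <= M] the index of [q] exceeds [L] and is lowered instead. Both results are
    partial sums of the coefficient at [m], so the constants add. *)
Lemma ratio_leM (R : realType) (p q : {poly R}) (M L : nat) (c c' : R) :
  (forall i, 0 <= p`_i) -> (forall i, 0 <= q`_i) -> 0 <= c -> 0 <= c' ->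
  ratio_le p M c -> ratio_le q L c' -> ratio_le (p * q) (M + L) (c + c').
Proof.
move=> p0 q0 c0 c'0 pc qc n; set m := (M + L + n)%N.
have pq0 i j : 0 <= p`_i * q`_j by rewrite mulr_ge0.
have Mm : (M <= m)%N by rewrite /m; lia.
rewrite !coefM mulrDl -(big_mkord xpredT (fun j => p`_j * q`_(m.+1 - j))).
rewrite -!(big_mkord xpredT (fun j => p`_j * q`_(m - j))).
rewrite (@big_cat_nat _ _ _ M.+1)//=; last by rewrite ltnS ltnW.
rewrite big_add1 /= addrC; apply: lerD.
  rewrite [in leRHS](@big_cat_nat _ _ _ M _ m.+1)//=; last by rewrite ltnW.
  rewrite mulrDr ler_wpDl ?mulr_ge0 ?sumr_ge0// mulr_sumr.
  rewrite !big_seq; apply: ler_sum => j; rewrite mem_index_iota => /andP[Mj jm].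
  rewrite subSS mulrA ler_wpM2r//.
  by have := pc (j - M)%N; rewrite subnKC.
rewrite [in leRHS](@big_cat_nat _ _ _ M.+1 _ m.+1)//= mulrDr.
rewrite ler_wpDr ?mulr_ge0 ?sumr_ge0// mulr_sumr.
rewrite !big_seq; apply: ler_sum => j; rewrite mem_index_iota ltnS => /= jM.
rewrite mulrCA ler_wpM2l// subSn; last exact: leq_trans jM Mm.
have := qc (m - j - L)%N; rewrite subnKC// /m; lia.
Qed.

Lemma ratio_leX (R : realType) (p : {poly R}) (M b : nat) (c : R) :
  (forall i, 0 <= p`_i) -> 0 <= c -> ratio_le p M c ->
  ratio_le (p ^+ b) (b * M) (b%:R * c).
Proof.
move=> p0 c0 pc; elim: b => [|b IH].
  by move=> n; rewrite mul0n add0n expr0 coef1 mul0r mul0r.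
rewrite exprS mulSn mulrS mulrDl mul1r.
by apply: ratio_leM => //; [exact: coefX_ge0|rewrite mulr_ge0].
Qed.

(** Reflect [p] about [M]. The sum is padded with zeros up to [M + L], so that [coefM_high_half],
    where [q] is reflected, has the same right-hand side. *)
Lemma coefM_low_half (R : realType) (p q : {poly R}) (M L : nat) :
  palindromic p M ->
  \sum_(0 <= j < M) p`_j * q`_(M + L - j) =
  \sum_(i < M + L) p`_(M + i).+1 * q`_(L + i).+1.
Proof.
move=> [sp pp].
rewrite -(big_mkord xpredT (fun i => p`_(M + i).+1 * q`_(L + i).+1)).
rewrite [RHS](@big_cat_nat _ _ _ M)//= ?leq_addr//.
rewrite [X in _ + X]big1_seq ?addr0; last first.
  move=> i /andP[_]; rewrite mem_index_iota => /andP[Mi _].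
  by rewrite nth_default ?mul0r// (leq_trans sp)// -addnn ltnS leq_add2l.
rewrite big_nat_rev /= !big_seq; apply: eq_bigr => j.
rewrite mem_index_iota add0n => /= jM.
have -> : (M + L - (M - j.+1) = (L + j).+1)%N by lia.
by rewrite -pp; [congr (_`_ _ * _); lia|lia].
Qed.

Lemma coefM_high_half (R : realType) (p q : {poly R}) (M L : nat) :
  palindromic q L ->
  \sum_(M.+1 <= j < (M + L).+1) p`_j * q`_(M + L - j) =
  \sum_(i < M + L) p`_(M + i).+1 * q`_(L + i).+1.
Proof.
move=> [sq pq].
rewrite -(big_mkord xpredT (fun i => p`_(M + i).+1 * q`_(L + i).+1)).
rewrite [RHS](@big_cat_nat _ _ _ L)//= ?leq_addl//.
rewrite [X in _ + X]big1_seq ?addr0; last first.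
  move=> i /andP[_]; rewrite mem_index_iota => /andP[Li _].
  by rewrite [q`__]nth_default ?mulr0// (leq_trans sq)// -addnn ltnS leq_add2l.
rewrite -[M.+1]add0n big_addn (_ : (M + L).+1 - M.+1 = L)%N; last by lia.
rewrite !big_seq; apply: eq_bigr => j.
rewrite mem_index_iota => /= jL.
rewrite addnS [(j + M)%N]addnC -[q`_(_ - _)]pq; last by lia.
by congr (_ * q`_ _); lia.
Qed.

Lemma coefM_center (R : realType) (p q : {poly R}) (M L : nat) :
  palindromic p M -> palindromic q L ->
  (p * q)`_(M + L) = p`_M * q`_L +
    2 * \sum_(i < M + L) p`_(M + i).+1 * q`_(L + i).+1.
Proof.
move=> pp pq; rewrite coefM.
rewrite -(big_mkord xpredT (fun j => p`_j * q`_(M + L - j))).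
rewrite (@big_cat_nat _ _ _ M)//=; last by lia.
rewrite [X in _ + X]big_ltn; last by lia.
by rewrite coefM_low_half// coefM_high_half// addKn; ring.
Qed.

(** The two terms [j = M] and [j = M + 1] are kept exactly and each remaining half is shifted as in
    [ratio_leM]. The off-centre sum thus gets the factor [c + c'] once, while [coefM_center]
    contains it twice: this is the source of the gain. *)
Lemma coefM_center_succ_le (R : realType) (p q : {poly R}) (M L : nat) (c c' : R) :
  (forall i, 0 <= p`_i) -> (forall i, 0 <= q`_i) ->
  palindromic p M -> palindromic q L -> ratio_le p M c -> ratio_le q L c' ->
  (p * q)`_(M + L).+1 <= p`_M * q`_L.+1 + p`_M.+1 * q`_L +
    (c + c') * \sum_(i < M + L) p`_(M + i).+1 * q`_(L + i).+1.
Proof.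
move=> p0 q0 pp pq pc qc; rewrite coefM.
rewrite -(big_mkord xpredT (fun j => p`_j * q`_((M + L).+1 - j))).
rewrite (@big_cat_nat _ _ _ M)//=; last by lia.
rewrite [X in _ + X]big_ltn; last by lia.
rewrite [X in _ + (_ + X)]big_ltn; last by lia.
rewrite big_add1/= !subSS addKn subSn ?leq_addr// addKn mulrDl.
rewrite -{1}(coefM_high_half _ _ pq) -(coefM_low_half _ _ pp) !mulr_sumr.
rewrite (_ : forall a b c d : R, a + (b + (c + d)) = (b + c) + (d + a)); last first.
  by move=> *; ring.
rewrite lerD2l lerD//.
  rewrite !big_seq; apply: ler_sum => j; rewrite mem_index_iota => /andP[Mj jm].
  rewrite subSS mulrA ler_wpM2r//.
  by have := pc (j - M)%N; rewrite subnKC// ltnW.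
rewrite !big_seq; apply: ler_sum => j; rewrite mem_index_iota => /= jM.
rewrite mulrCA ler_wpM2l// subSn; last by lia.
by have := qc (M + L - j - L)%N; rewrite subnKC//; lia.
Qed.

Lemma coefX_center_gt0 (R : realType) (p : {poly R}) (M b : nat) :
  (forall i, 0 <= p`_i) -> palindromic p M -> 0 < p`_M -> 0 < (p ^+ b)`_(b * M).
Proof.
move=> p0 pp pM; elim: b => [|b IH]; first by rewrite expr0 mul0n coef1.
rewrite exprS mulSn coefM_center//; last exact: palindromicX.
rewrite ltr_pwDl ?mulr_gt0// mulr_ge0// sumr_ge0// => i _.
by rewrite mulr_ge0// coefX_ge0.
Qed.

(* If one of the two ratios [P1 / P0], [Q1 / Q0] is below [theta * c], the
   linear term already gains a constant factor; otherwise [U] carries a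
   fraction of order [c ^+ 2] of the mass [P0 * Q0 + 2 * U]. *)
Lemma ratio_gain (R : realType) (theta c delta P0 P1 Q0 Q1 U : R) :
  0 < theta -> theta <= 1 / 2 -> 0 <= c -> 0 <= delta ->
  4 * delta <= theta ^+ 2 -> 4 * (delta * c ^+ 2) <= theta ^+ 2 ->
  0 <= P0 -> 0 <= P1 -> 0 <= Q0 -> 0 <= Q1 ->
  P1 <= c * P0 -> theta * Q1 <= (1 - theta) * c * Q0 -> P1 * Q1 <= U ->
  theta * (P0 * Q1 + P1 * Q0) + c * U <=
  c * (1 - delta * c ^+ 2) * (P0 * Q0 + 2 * U).
Proof.
move=> t0 t12 c0 d0 dt dct P00 P10 Q00 Q10 P1le Q1le Ule.
set e := delta * c ^+ 2 in dct *.
have e0 : 0 <= e by rewrite mulr_ge0// sqr_ge0.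
have U0 : 0 <= U by apply: le_trans Ule; rewrite mulr_ge0.
have Z0 : 0 <= P0 * Q0 by rewrite mulr_ge0.
have tt : theta ^+ 2 <= 1 / 4 by nra.
have e4 : e <= 1 / 16 by lra.
have PQ : theta * (P0 * Q1) <= (1 - theta) * c * (P0 * Q0).
  by have := ler_wpM2l P00 Q1le; lra.
have QP : P1 * Q0 <= c * (P0 * Q0) by have := ler_wpM2r Q00 P1le; lra.
(* [k] is the share of [P0 * Q0] used by the linear terms. If [P1] or [Q1] is small, [k <= 1 - e]
   and [gain] applies; otherwise [k = 1] and [U >= 4 * e * (P0 * Q0)] makes up for [e]. *)
suff [k [kU kle]] : exists k, k * (P0 * Q0) + U <= (1 - e) * (P0 * Q0 + 2 * U) /\
    theta * (P0 * Q1 + P1 * Q0) <= c * (k * (P0 * Q0)).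
  by have := ler_wpM2l c0 kU; lra.
have gain k : k <= 1 - e -> k * (P0 * Q0) + U <= (1 - e) * (P0 * Q0 + 2 * U).
  by move=> ke; have := ler_wpM2r Z0 ke; have := ler_wpM2r U0 e4; lra.
have [P1s|P1l] := leP P1 (theta * c * P0).
  exists (1 - theta + theta ^+ 2); split; first by apply: gain; nra.
  have := ler_wpM2r Q00 P1s => h; have := ler_wpM2l (ltW t0) h; lra.
have [Q1s|Q1l] := leP Q1 (theta * c * Q0).
  exists (theta + theta ^+ 2); split; first by apply: gain; nra.
  have := ler_wpM2l P00 Q1s => h; have := ler_wpM2l (ltW t0) h.
  have := ler_wpM2l (ltW t0) QP; lra.
exists 1; split; last by have := ler_wpM2l (ltW t0) QP; lra.
have tc0 : 0 <= theta * c by rewrite mulr_ge0// ltW.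
have UZ : theta ^+ 2 * c ^+ 2 * (P0 * Q0) <= U.
  apply: le_trans Ule; rewrite (_ : _ * _ = theta * c * P0 * (theta * c * Q0)); last first.
    by ring.
  by apply: ler_pM; rewrite ?mulr_ge0// ltW.
have : 4 * e * (P0 * Q0) <= U.
  apply: le_trans UZ; apply: ler_wpM2r => //; rewrite /e mulrA.
  by apply: ler_wpM2r => //; exact: sqr_ge0.
have := ler_wpM2r U0 e4; lra.
Qed.

(** The sum of two truncated subtractions, one of which vanishes, is the frequency
    [n = |i - b * M|]; the Gaussian average multiplies that mode by [theta ^ (n ^ 2)]. *)
Definition renorm_poly (R : realType) (theta : R) (b M : nat) (p : {poly R}) : {poly R} :=
  \poly_(i < (b * M).*2.+1) (theta ^+ (((i - b * M) + (b * M - i)) ^ 2) * (p ^+ b)`_i).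

Lemma renorm_poly_ge0 (R : realType) (theta : R) (b M : nat) (p : {poly R}) :
  0 <= theta -> (forall i, 0 <= p`_i) -> forall i, 0 <= (renorm_poly theta b M p)`_i.
Proof.
move=> t0 p0 i; rewrite coef_poly; case: ifP => // _.
by rewrite mulr_ge0 ?exprn_ge0// coefX_ge0.
Qed.

Lemma palindromic_renorm (R : realType) (theta : R) (b M : nat) (p : {poly R}) :
  palindromic p M -> palindromic (renorm_poly theta b M p) (b * M).
Proof.
move=> /(palindromicX b)[_ pp]; split; first exact: size_poly.
move=> i ib; rewrite !coef_poly !ltnS leq_subr ib pp//.
by congr (_ ^+ (_ ^ 2) * _); rewrite -addnn in ib *; lia.
Qed.

Lemma coef_renorm_poly (R : realType) (theta : R) (b M n : nat) (p : {poly R}) :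
  palindromic p M ->
  (renorm_poly theta b M p)`_(b * M + n) = theta ^+ (n ^ 2) * (p ^+ b)`_(b * M + n).
Proof.
move=> /(palindromicX b)[sp _]; rewrite coef_poly; case: ifPn => [_|].
  by rewrite (_ : (_ - _) + _ = n)%N//; lia.
by rewrite -leqNgt => h; rewrite (nth_default _ (leq_trans sp h)) mulr0.
Qed.

Lemma ratio_le_renorm (R : realType) (theta : R) (b M : nat) (p : {poly R})
    (c delta : R) :
  (2 <= b)%N -> b%:R * theta = 1 -> 0 <= c -> 0 <= delta ->
  4 * delta <= theta ^+ 2 -> 4 * (delta * c ^+ 2) <= theta ^+ 2 ->
  (forall i, 0 <= p`_i) -> palindromic p M -> ratio_le p M c ->
  ratio_le (renorm_poly theta b M p) (b * M) (c * (1 - delta * c ^+ 2)).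
Proof.
move=> b2 bt c0 d0 dt dct p0 pp pc.
have b2R : 2 <= b%:R :> R by rewrite ler_nat.
have b0 : 0 < b%:R :> R by rewrite ltr0n; lia.
have t0 : 0 < theta by rewrite -(pmulr_rgt0 _ b0) bt ltr01.
have t12 : theta <= 1 / 2 by have := ler_wpM2r (ltW t0) b2R; lra.
have tt : theta ^+ 2 <= 1 / 4 by nra.
case=> [|n].
  rewrite -addnS !coef_renorm_poly// exp1n expr0 mul1r expr1.
  (* From here [b] is the former [b - 1]: one factor [p] is split off, and [theta * b = 1 - theta]
     for the rest. *)
  case: b b2 bt {b2R b0} => [//|b] b2 bt; rewrite addn0 addn1 exprS mulSn.
  have bE : theta * b%:R = 1 - theta by move: bt; rewrite -natr1; lra.
  have pb0 := coefX_ge0 b p0.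
  have pbc := ratio_leX b p0 c0 pc.
  have ppb := palindromicX b pp.
  have h := coefM_center_succ_le p0 pb0 pp ppb pc pbc.
  apply: le_trans (ler_wpM2l (ltW t0) h) _.
  rewrite mulrDr coefM_center//.
  set U := \sum_(i < _) _.
  rewrite [theta * (_ * U)](_ : _ = c * U); last first.
    by rewrite mulrA mulrDr mulrA bE; ring.
  apply: ratio_gain => //; first by have := pc 0; rewrite addn0.
    have := pbc 0; rewrite addn0 => /(ler_wpM2l (ltW t0)) /le_trans; apply.
    by rewrite !mulrA bE.
  (* [P1 * Q1] is the term [i = 0] of [U]; for [M = 0] the sum is empty, but then [P1] vanishes. *)
  rewrite /U; case: (M) pp (@pp) => [|M'] [sp _] _.
    rewrite [p`_1]nth_default ?mul0r//; apply: sumr_ge0 => i _.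
    by rewrite mulr_ge0.
  rewrite -[(M'.+1 + _)%N]/((M' + b * M'.+1).+1)%N big_ord_recl /= !addn0 lerDl.
  by rewrite sumr_ge0// => i _; rewrite mulr_ge0.
rewrite -addnS !coef_renorm_poly//.
have h := ratio_leX b p0 c0 pc n.+1.
rewrite -addnS in h.
(* Of the [2 n + 3] additional powers of [theta], one cancels [b], two are at most
   [1 - delta * c ^ 2], and the others are bounded by 1. *)
have -> : (n.+2 ^ 2 = n.+1 ^ 2 + 1 + 2 + n.*2)%N by rewrite -!mulnn -addnn; lia.
rewrite !exprD.
have tn : theta ^+ n.*2 <= 1 by rewrite exprn_ile1// ?ltW//; lra.
set A := theta ^+ (n.+1 ^ 2).
have A0 : 0 <= A by rewrite exprn_ge0// ltW.
set X := (p ^+ b)`_(b * M + n.+1) in h *.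
have X0 : 0 <= X by exact: coefX_ge0.
apply: (@le_trans _ _ (A * theta * theta ^+ 2 * (b%:R * c * X))).
  apply: ler_pM => //; [|exact: coefX_ge0|].
    by rewrite !mulr_ge0// ?exprn_ge0// ltW.
  by rewrite ler_piMr// !mulr_ge0// ?exprn_ge0// ltW.
rewrite (_ : _ * (b%:R * c * X) =
  (b%:R * theta) * (theta ^+ 2 * (c * (A * X)))); last by ring.
rewrite bt mul1r [leRHS](_ : _ = (1 - delta * c ^+ 2) * (c * (A * X))); last by ring.
by apply: ler_wpM2r; [rewrite !mulr_ge0|lra].
Qed.

(** * Even trigonometric polynomials *)

(** Cosines suffice: for palindromic coefficients the sine part vanishes, by
    [palindromic_sin_eq0]. *)
Definition trig_eval (R : realType) (p : {poly R}) (M : nat) (z : R) : R :=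
  \sum_(i < M.*2.+1) p`_i * cos (2 * pi * (i%:R - M%:R) * z).

Lemma palindromic_sin_eq0 (R : realType) (p : {poly R}) (M : nat) (z : R) :
  palindromic p M ->
  \sum_(i < M.*2.+1) p`_i * sin (2 * pi * (i%:R - M%:R) * z) = 0.
Proof.
move=> [_ pp]; set S := \sum_(i < _) _.
suff : S = - S by lra.
rewrite /S {1}(reindex_inj rev_ord_inj) /= -sumrN; apply: eq_bigr => i _.
rewrite subSS pp; last by rewrite -ltnS.
rewrite natrB; last by rewrite -ltnS.
rewrite -mulrN -sinN; congr (_ * sin _).
by rewrite -[in X in X%:R - _ - _]addnn natrD; ring.
Qed.

(** The product of the sine sums, which is zero, is subtracted so that the addition formula for the
    cosine applies term by term. *)
Lemma trig_evalM (R : realType) (p q : {poly R}) (M L : nat) (z : R) :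
  palindromic p M -> palindromic q L ->
  trig_eval (p * q) (M + L) z = trig_eval p M z * trig_eval q L z.
Proof.
move=> pp pq.
transitivity (trig_eval p M z * trig_eval q L z -
  (\sum_(i < M.*2.+1) p`_i * sin (2 * pi * (i%:R - M%:R) * z)) *
  (\sum_(i < L.*2.+1) q`_i * sin (2 * pi * (i%:R - L%:R) * z))); last first.
  by rewrite palindromic_sin_eq0// mul0r subr0.
rewrite /trig_eval !big_distrlr /= -sumrB.
under eq_bigr do rewrite (coefM_window _ pp.1 pq.1) mulr_suml.
rewrite exchange_big; apply: eq_bigr => j _ /=; rewrite -sumrB.
under eq_bigr do rewrite mulr_suml.
rewrite exchange_big; apply: eq_bigr => k _ /=.
have jk : (j + k < (M + L).*2.+1)%N.
  by move: (ltn_ord j) (ltn_ord k); lia.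
rewrite (bigD1 (Ordinal jk)) //= eqxx big1 ?addr0; last first.
  move=> i ne; rewrite (_ : (j + k == i)%N = false) ?mul0r//.
  by apply: contra_neqF ne => /eqP h; apply: val_inj.
rewrite mulr1n (_ : 2 * pi * _ * z =
  2 * pi * (j%:R - M%:R) * z + 2 * pi * (k%:R - L%:R) * z).
  by rewrite cosD; ring.
by rewrite !natrD; ring.
Qed.

Lemma trig_evalX (R : realType) (p : {poly R}) (M b : nat) (z : R) :
  palindromic p M -> trig_eval (p ^+ b) (b * M) z = trig_eval p M z ^+ b.
Proof.
move=> pp; elim: b => [|b IH]; last first.
  by rewrite exprS mulSn trig_evalM// ?IH ?exprS//; exact: palindromicX.
by rewrite mul0n !expr0 /trig_eval big_ord1 coef1 subrr mulr0 mul0r cos0 mulr1.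
Qed.

Lemma trig_eval_norm_le (R : realType) (p : {poly R}) (M : nat) (z : R) :
  (forall i, 0 <= p`_i) -> `|trig_eval p M z| <= trig_eval p M 0.
Proof.
move=> p0; apply: le_trans (ler_norm_sum _ _ _) _; apply: ler_sum => i _.
by rewrite mulr0 cos0 normrM (ger0_norm (p0 i)) ler_wpM2l// cos_max.
Qed.

Lemma measurable_trig_eval (R : realType) (p : {poly R}) (M : nat) :
  measurable_fun [set: R] (trig_eval p M).
Proof.
apply: measurable_sum => i; apply: measurable_funM => //.
by apply: (measurableT_comp (@measurable_cos R)); exact: measurable_funM.
Qed.

Lemma trig_eval_center_le (R : realType) (p : {poly R}) (M : nat) (eps z : R) :
  0 <= eps -> eps <= 1 / 8 -> (forall i, 0 <= p`_i) -> palindromic p M ->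
  (forall n, p`_(M + n) <= eps ^+ n * p`_M) ->
  `|trig_eval p M z - p`_M| <= 16 / 7 * eps * p`_M.
Proof.
move=> e0 e8 p0 [_ pp] pe.
have geo m : \sum_(i < m) eps ^+ i.+1 <= 8 / 7 * eps.
  under eq_bigr do rewrite exprS.
  rewrite -mulr_sumr mulrC ler_wpM2r//.
  have := subrX1 eps m; have := exprn_ge0 m e0.
  have : 0 <= \sum_(i < m) eps ^+ i by apply: sumr_ge0 => i _; exact: exprn_ge0.
  move: (eps ^+ m) (\sum_(i < m) _) => x y; nra.
have half : \sum_(i < M) p`_(M + i).+1 <= 8 / 7 * eps * p`_M.
  apply: le_trans (_ : \sum_(i < M) eps ^+ i.+1 * p`_M <= _); last first.
    by rewrite -mulr_suml ler_wpM2r.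
  by apply: ler_sum => i _; rewrite -addnS.
pose t i := p`_i * cos (2 * pi * (i%:R - M%:R) * z).
have tp i : `|t i| <= p`_i by rewrite normrM (ger0_norm (p0 i)) ler_piMr// cos_max.
rewrite /trig_eval -(big_mkord xpredT t) (@big_cat_nat _ _ _ M)//=; last by lia.
rewrite [\sum_(M <= i < _) _]big_ltn; last by lia.
rewrite {2}/t subrr mulr0 mul0r cos0 mulr1 addrCA addrAC subrr add0r.
apply: le_trans (ler_normD _ _) _.
rewrite (_ : 16 / 7 * eps * p`_M =
  8 / 7 * eps * p`_M + 8 / 7 * eps * p`_M); last by field.
apply: lerD; apply: le_trans (ler_norm_sum _ _ _) _; apply: le_trans half.
  rewrite big_nat_rev /= -(big_mkord xpredT (fun i => p`_(M + i).+1)) !big_seq.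
  apply: ler_sum => j; rewrite mem_index_iota add0n => /= jM.
  apply: le_trans (tp _) _; rewrite -pp; last by lia.
  by rewrite (_ : M.*2 - _ = (M + j).+1)%N//; lia.
rewrite -[M.+1]add0n big_addn (_ : M.*2.+1 - M.+1 = M)%N; last by lia.
rewrite -(big_mkord xpredT (fun i => p`_(M + i).+1)).
by apply: ler_sum => j _; rewrite addnS addnC.
Qed.

Lemma bounded_RV_integrable (d : measure_display) (T : measurableType d)
    (R : realType) (P : probability T R) (f : T -> R) (B : R) :
  measurable_fun setT f -> (forall w, `|f w| <= B) ->
  P.-integrable setT (EFin \o f).
Proof.
move=> mf fB; apply: (@le_integrable _ _ _ _ _ _ _ (cst B%:E)) => //.
- exact/measurable_EFinP.
- by move=> w _; rewrite /= lee_fin (le_trans (fB w))// ler_norm.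
- exact: finite_measure_integrable_cst.
Qed.

(** Expand the power as a convolution and average each mode: frequency [n] acquires [e^(- (2 pi n)^2
    / (2 beta)) = theta^(n^2)]. *)
Lemma expectation_trig_eval (d : measure_display) (T : measurableType d)
    (R : realType) (P : probability T R) (zeta : {RV P >-> R}) (beta theta : R)
    (p : {poly R}) (b M : nat) (z : R) :
  0 < beta -> centered_normal zeta beta -> theta = expR (- (2 * pi ^+ 2 / beta)) ->
  palindromic p M ->
  (\int[P]_w (trig_eval p M (z + zeta w) ^+ b)%:E =
   (trig_eval (renorm_poly theta b M p) (b * M) z)%:E)%E.
Proof.
move=> beta0 hz tE pp.
pose t (i : 'I_(b * M).*2.+1) := 2 * pi * (i%:R - (b * M)%:R) : R.
have ic i : P.-integrable setT (EFin \o (fun w => cos (t i * z + t i * zeta w))).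
  apply: (@bounded_RV_integrable _ _ _ _ _ 1) => [|w]; last exact: cos_max.
  apply: (measurableT_comp (@measurable_cos R)); apply: measurable_funD => //.
  exact: measurable_funM.
transitivity (\int[P]_w (\sum_(i < (b * M).*2.+1)
    ((p ^+ b)`_i)%:E * (cos (t i * z + t i * zeta w))%:E))%E.
  apply: eq_integral => w _; rewrite -trig_evalX// -sumEFin; apply: eq_bigr => i _.
  by rewrite -EFinM -mulrDr.
rewrite integral_sum//; last first.
  by move=> i; have := integrableZl measurableT ((p ^+ b)`_i) (ic i).
rewrite /trig_eval -sumEFin; apply: eq_bigr => i _.
rewrite integralZl//; last exact: ic.
rewrite [X in (_ * X)%E](integral_cos_centered_normal _ _ beta0 hz) -EFinM.
congr EFin; rewrite coef_poly ltn_ord.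
suff -> : expR (- (t i ^+ 2 / (2 * beta))) =
    theta ^+ ((i - b * M + (b * M - i)) ^ 2) by rewrite /t mulrA mulrC mulrA.
rewrite tE -expRM_natl; congr expR; rewrite /t.
have -> : (((i - b * M + (b * M - i)) ^ 2)%:R = (i%:R - (b * M)%:R) ^+ 2 :> R).
  rewrite natrX natrD; have [h|h] := leqP (b * M) i.
    by rewrite (eqP h) addr0 natrB.
  by rewrite (eqP (ltnW h)) add0r natrB ?(ltnW h)//; ring.
by field; rewrite gt_eqF.
Qed.

(** * Uniqueness of Fourier coefficients *)

Lemma sum_complex (R : realType) (I : Type) (r : seq I) (x y : I -> R) :
  \sum_(i <- r) (x i +i* y i)%C = ((\sum_(i <- r) x i) +i* (\sum_(i <- r) y i))%C.
Proof.
elim: r => [|i r IH]; first by rewrite !big_nil.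
by rewrite !big_cons IH.
Qed.

Lemma cvg_complex (R : realType) (u : nat -> R[i]^o) (l : R[i]^o) :
  u n @[n --> \oo] --> l ->
  (complex.Re (u n) @[n --> \oo] --> complex.Re l) /\
  (complex.Im (u n) @[n --> \oo] --> complex.Im l).
Proof.
move=> /cvgrPdist_lt ul.
have ule (e : R) : 0 < e -> \forall n \near \oo,
    Num.sqrt (complex.Re (l - u n) ^+ 2 + complex.Im (l - u n) ^+ 2) < e.
  move=> e0; have e0C : 0 < (e%:C)%C :> R[i] by rewrite ltcR.
  by apply: filterS (ul _ e0C) => n; rewrite normc_def ltcR.
have subRe (x y : R[i]) : complex.Re (x - y) = complex.Re x - complex.Re y.
  by case: x; case: y.
have subIm (x y : R[i]) : complex.Im (x - y) = complex.Im x - complex.Im y.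
  by case: x; case: y.
split; apply/cvgrPdist_lt => e /ule; apply: filterS => n; apply: le_lt_trans.
  by rewrite -subRe -sqrtr_sqr ler_wsqrtr// lerDl sqr_ge0.
by rewrite -subIm -sqrtr_sqr ler_wsqrtr// lerDr sqr_ge0.
Qed.

Definition cos_partial_sum (R : realType) (a : int -> R) (z : R) (N : nat) : R :=
  \sum_(j < N.*2.+1) a (j%:Z - N%:Z) * cos (2 * pi * (j%:Z - N%:Z)%:~R * z).

Definition sin_partial_sum (R : realType) (a : int -> R) (z : R) (N : nat) : R :=
  \sum_(j < N.*2.+1) a (j%:Z - N%:Z) * sin (2 * pi * (j%:Z - N%:Z)%:~R * z).

Lemma fourier_repr_cvg (R : realType) (v : R -> R) (a : int -> R) (z : R) :
  fourier_repr v a ->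
  (cos_partial_sum a z N @[N --> \oo] --> expR (- v z)) /\
  (sin_partial_sum a z N @[N --> \oo] --> 0).
Proof.
move=> [_ _ /(_ z)] /cvg_complex[/= hc hs].
have E N : fourier_partial_sum a z N =
    ((cos_partial_sum a z N) +i* (sin_partial_sum a z N))%C.
  rewrite /fourier_partial_sum -sum_complex; apply: eq_bigr => j _ /=.
  by apply/eqP; rewrite eq_complex /= !mul0r subr0 addr0 !eqxx.
have cE : cos_partial_sum a z = fun N => complex.Re (fourier_partial_sum a z N).
  by apply/funext => N; rewrite E.
have sE : sin_partial_sum a z = fun N => complex.Im (fourier_partial_sum a z N).
  by apply/funext => N; rewrite E.
by rewrite cE sE.
Qed.

(** [G] shifts frequency [m] to zero. Averaging [G N (t * x)] against a standard Gaussian leaves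
    [d m] unchanged and damps every other coefficient by at least [e^(- (2 pi t)^2 / 2)], while the
    average tends to 0 with growing [N]. Hence [key], and then [t] is taken large. *)
Lemma fourier_coef_eq0 (R : realType) (d : int -> R) (B : R) :
  (forall N, \sum_(j < N.*2.+1) `|d (j%:Z - N%:Z)| <= B) ->
  (forall z, cos_partial_sum d z N @[N --> \oo] --> 0) ->
  (forall z, sin_partial_sum d z N @[N --> \oo] --> 0) ->
  forall m, d m = 0.
Proof.
move=> dB dc ds m.
have B0 : 0 <= B by apply: le_trans (dB 0%N); exact: sumr_ge0.
pose g := normal_pdf 0 1 : R -> R.
have g0 x : 0 <= g x by exact: normal_pdf_ge0.
have mg : measurable_fun setT g by exact: measurable_normal_pdf.
have ig : lebesgue_measure.-integrable setT (EFin \o g).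
  exact: integrable_normal_pdf.
pose G N x := \sum_(j < N.*2.+1)
  d (j%:Z - N%:Z) * cos (2 * pi * (j%:Z - N%:Z - m)%:~R * x).
have GE N x : G N x = cos (2 * pi * m%:~R * x) * cos_partial_sum d x N +
    sin (2 * pi * m%:~R * x) * sin_partial_sum d x N.
  rewrite !mulr_sumr -big_split /=; apply: eq_bigr => j _.
  rewrite (_ : _ * x = 2 * pi * (j%:Z - N%:Z)%:~R * x - 2 * pi * m%:~R * x).
    by rewrite cosB; ring.
  by rewrite intrB; ring.
have G0 x : G N x @[N --> \oo] --> 0.
  under eq_fun do rewrite GE.
  rewrite -[0]addr0 -[X in X + _](mulr0 (cos (2 * pi * m%:~R * x))).
  rewrite -[X in _ + X](mulr0 (sin (2 * pi * m%:~R * x))).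
  by apply: cvgD; apply: cvgMr.
have GB N x : `|G N x| <= B.
  apply: le_trans (dB N); apply: le_trans (ler_norm_sum _ _ _) _.
  by apply: ler_sum => j _; rewrite normrM ler_piMr// cos_max.
have mG N : measurable_fun setT (G N).
  apply: measurable_sum => j; apply: measurable_funM => //.
  by apply: (measurableT_comp (@measurable_cos R)); exact: measurable_funM.
have I0 t : (\int[lebesgue_measure]_x (G N (t * x) * g x)%:E)%E @[N --> \oo] --> 0%E.
  have iBg : lebesgue_measure.-integrable setT (EFin \o (fun x => B * g x)).
    by have := integrableZl measurableT B ig.
  have mGg N : measurable_fun setT (EFin \o (fun x : R => G N (t * x) * g x)).
    apply/measurable_EFinP; apply: measurable_funM => //.
    by apply: (measurableT_comp (mG N)); exact: measurable_funM.
  have [|||||_ _] := @dominated_convergence _ _ _ lebesgue_measure setT measurableT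
    (fun N => EFin \o (fun x => G N (t * x) * g x)) (cst 0%E)
    (EFin \o (fun x => B * g x)) => //.
  - apply: aeW => x _; apply: cvg_EFin; first exact: nearW.
    by rewrite -[0](mul0r (g x)); apply: cvgMl; exact: G0.
  - by apply: aeW => x N _; rewrite /= lee_fin normrM (ger0_norm (g0 x)) ler_wpM2r.
  - by rewrite integral0.
have IE t N : (\int[lebesgue_measure]_x (G N (t * x) * g x)%:E)%E =
    (\sum_(j < N.*2.+1) d (j%:Z - N%:Z) *
      expR (- ((2 * pi * t) ^+ 2 / 2 * (j%:Z - N%:Z - m)%:~R ^+ 2)))%:E.
  pose w (j : 'I_N.*2.+1) := 2 * pi * (j%:Z - N%:Z - m)%:~R * t.
  have ic j : lebesgue_measure.-integrable setT
      (EFin \o (fun x => cos (0 + w j * x) * g x)).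
    apply: (le_integrable _ _ _ ig) => //.
      apply/measurable_EFinP/measurable_funM => //.
      apply: (measurableT_comp (@measurable_cos R)).
      by apply: measurable_funD => //; exact: measurable_funM.
    by move=> x _; rewrite /= lee_fin normrM ler_piMl// cos_max.
  transitivity (\int[lebesgue_measure]_x (\sum_(j < N.*2.+1)
      (d (j%:Z - N%:Z))%:E * (cos (0 + w j * x) * g x)%:E))%E.
    apply: eq_integral => x _; rewrite /G mulr_suml -sumEFin; apply: eq_bigr => j _.
    by rewrite -EFinM add0r -[in LHS]mulrA; congr (_ * (cos _ * _))%:E; rewrite /w; ring.
  rewrite integral_sum//; last first.
    by move=> j; have := integrableZl measurableT (d (j%:Z - N%:Z)) (ic j).
  rewrite -sumEFin; apply: eq_bigr => j _.
  rewrite integralZl//; last exact: ic.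
  rewrite [X in (_ * X)%E](integral_cos_normal_pdf 0 (w j) (oner_neq0 R)).
  rewrite -EFinM cos0 mul1r.
  by congr (_ * expR (- _))%:E; rewrite /w; field.
have key t : `|d m| <= expR (- ((2 * pi * t) ^+ 2 / 2)) * B.
  set y := (2 * pi * t) ^+ 2 / 2.
  have y0 : 0 <= y by rewrite divr_ge0// sqr_ge0.
  apply/ler_addgt0Pr => e e0.
  have := I0 t; under eq_fun do rewrite IE -/y.
  move=> /fine_cvg/= /cvgrPdist_lt/(_ _ e0) H.
  near \oo => N.
  have SN : `|0 - \sum_(j < N.*2.+1) d (j%:Z - N%:Z) *
      expR (- (y * (j%:Z - N%:Z - m)%:~R ^+ 2))| < e by near: N; exact: H.
  have mN : (`|m| <= N)%N by near: N; exact: nbhs_infty_ge.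
  (* The frequency [m] sits at index [N + m], inside the window once [|m| <= N]. *)
  have jN : (absz (N%:Z + m)%R < N.*2.+1)%N by lia.
  have jE : (Ordinal jN)%:Z - N%:Z = m by rewrite /=; lia.
  move: SN; rewrite (bigD1 (Ordinal jN))//= jE subrr expr0n/= mulr0 oppr0 expR0 mulr1.
  set S := \sum_(j < _ | _) _ => SN.
  have SB : `|S| <= expR (- y) * B.
    apply: le_trans (ler_norm_sum _ _ _) _.
    apply: le_trans (ler_wpM2l (expR_ge0 _) (dB N)).
    rewrite mulr_sumr [leRHS](bigD1 (Ordinal jN))//= ler_wpDl ?mulr_ge0 ?expR_ge0//.
    apply: ler_sum => j jne; rewrite normrM (ger0_norm (expR_ge0 _)) mulrC ler_wpM2r//.
    rewrite ler_expR lerN2 ler_peMr//.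
    rewrite sqr_intr_ge1 ?rpred_int// intr_eq0.
    by apply: contra jne => /eqP jm; apply/eqP/val_inj => /=; lia.
  rewrite (_ : d m = - (0 - (d m + S)) - S); last by ring.
  apply: le_trans (ler_normB _ _) _; rewrite normrN addrC; apply: lerD => //; exact: ltW.
apply/eqP; rewrite -normr_eq0; apply/negP => /negP dm0.
have {}dm0 : 0 < `|d m| by rewrite lt_def dm0 normr_ge0.
(* Chosen so that [|d m| * (1 + t) = 2 * |d m| + B] exceeds [B]; as the damping factor is at most
   [1 / (1 + t)], this contradicts [key]. *)
pose t := 1 + B / `|d m|.
have t1 : 1 <= t by rewrite lerDl divr_ge0.
have := key t; apply/negP; rewrite -ltNge.
have ty : t <= (2 * pi * t) ^+ 2 / 2.
  have := pi_ge2 R => p2.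
  rewrite (_ : _ / 2 = 2 * pi ^+ 2 * t * t); last by field.
  rewrite ler_peMl//; first lra.
  nra.
have h : expR (- ((2 * pi * t) ^+ 2 / 2)) * (1 + t) <= 1.
  rewrite expRN mulrC ler_pdivrMr ?expR_gt0// mul1r.
  by apply: le_trans (expR_ge1Dx _); rewrite lerD2l.
have q0 := expR_gt0 (- ((2 * pi * t) ^+ 2 / 2)).
move: (expR _) h q0 => q h q0.
have : q * (`|d m| * (1 + t)) <= `|d m|.
  by have := ler_wpM2l (ltW dm0) h; lra.
rewrite (_ : `|d m| * (1 + t) = 2 * `|d m| + B); last first.
  by rewrite /t; field; rewrite gt_eqF.
have : 0 < q * `|d m| by rewrite mulr_gt0.
lra.
Unshelve. all: by end_near.
Qed.

Lemma fourier_repr_le (R : realType) (v : R -> R) (a : int -> R) :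
  fourier_repr v a ->
  exists B, forall N, \sum_(j < N.*2.+1) a (j%:Z - N%:Z) <= B.
Proof.
move=> va; have [h _] := fourier_repr_cvg 0 va.
have /cvg_seq_bounded [B [_ hB]] : cvgn (cos_partial_sum a 0).
  by apply/cvg_ex; exists (expR (- v 0)).
exists (B + 1) => N; apply: le_trans (hB (B + 1) _ N I); last by rewrite ltrDl.
apply: le_trans (ler_norm _); rewrite /cos_partial_sum.
by under [leRHS]eq_bigr do rewrite mulr0 cos0 mulr1.
Qed.

(** It makes the sequence whose existence [calV] asserts the same as any given representing
    sequence. *)
Lemma fourier_repr_inj (R : realType) (v : R -> R) (a a' : int -> R) :
  fourier_repr v a -> fourier_repr v a' -> a = a'.
Proof.
move=> va va'; apply/funext => m; apply/eqP; rewrite -subr_eq0; apply/eqP.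
have [B aB] := fourier_repr_le va; have [B' aB'] := fourier_repr_le va'.
have a0 n : 0 <= a n by have [+ _ _] := va; move=> /(_ n)/ltW.
have a'0 n : 0 <= a' n by have [+ _ _] := va'; move=> /(_ n)/ltW.
apply: (@fourier_coef_eq0 R (fun n => a n - a' n) (B + B')) => [N|z|z].
- apply: le_trans (lerD (aB N) (aB' N)); rewrite -big_split; apply: ler_sum => j _ /=.
  by apply: le_trans (ler_normB _ _) _; rewrite !ger0_norm.
- rewrite (_ : cos_partial_sum _ z =
      fun N => cos_partial_sum a z N - cos_partial_sum a' z N).
    rewrite -(subrr (expR (- v z))).
    by apply: cvgB; apply: (fourier_repr_cvg z _).1.
  by apply/funext => N; rewrite -sumrB; apply: eq_bigr => j _; rewrite mulrBl.
- rewrite (_ : sin_partial_sum _ z =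
      fun N => sin_partial_sum a z N - sin_partial_sum a' z N).
    rewrite -(subrr 0).
    by apply: cvgB; [apply: (fourier_repr_cvg z va).2|apply: (fourier_repr_cvg z va').2].
  by apply/funext => N; rewrite -sumrB; apply: eq_bigr => j _; rewrite mulrBl.
Qed.

(** By evenness of [v] the reflected sequence represents [v] too, and uniqueness applies. *)
Lemma fourier_repr_even (R : realType) (v : R -> R) (a : int -> R) :
  (forall z, v (- z) = v z) -> fourier_repr v a -> forall n, a (- n) = a n.
Proof.
move=> ve va n; have [a0 sa fa] := va.
suff : fourier_repr v (fun n => a (- n)).
  by move=> /fourier_repr_inj/(_ va)/(congr1 (@^~ n)).
split=> // [|z].
  have bijN : set_bij [set: int] [set: int] (fun n => - n).
    split=> // [x y _ _ /oppr_inj//|x _]; by exists (- x) => //; exact: opprK.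
  by rewrite /summable -(@reindex_esum R _ _ _ _ _ (fun n => `|(a n)%:E|%E) bijN).
rewrite -ve (_ : fourier_partial_sum _ z = fourier_partial_sum a (- z)); first exact: fa.
apply/funext => N; rewrite /fourier_partial_sum (reindex_inj rev_ord_inj) /=.
apply: eq_bigr => j _; have jN := ltn_ord j.
have -> : - ((N.*2.+1 - j.+1)%N%:Z - N%:Z) = j%:Z - N%:Z by lia.
have -> : (N.*2.+1 - j.+1)%N%:Z - N%:Z = - (j%:Z - N%:Z) by lia.
by congr (_ * expi _); rewrite mulrNz; ring.
Qed.

(** * Iterated renormalization *)

Lemma trig_eval_renorm_le (R : realType) (theta : R) (p : {poly R}) (b M : nat) (z : R) :
  0 <= theta -> theta <= 1 -> (forall i, 0 <= p`_i) -> palindromic p M ->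
  `|trig_eval (renorm_poly theta b M p) (b * M) z| <= trig_eval p M 0 ^+ b.
Proof.
move=> t0 t1 p0 pp.
apply: le_trans (trig_eval_norm_le _ _ (renorm_poly_ge0 b M t0 p0)) _.
rewrite -trig_evalX//; apply: ler_sum => i _.
rewrite mulr0 cos0 !mulr1 coef_poly ltn_ord ler_piMl ?coefX_ge0//.
exact: exprn_ile1.
Qed.

(** A discrete form of [x' = - delta x^3], solved by [x = c s^(-1/2)] with [s' = 2 delta c^2]. With
    [u = delta c^2 / s] the claim is [(1 - u)^2 (1 + 2 u) <= 1], that is [2 u^3 <= 3 u^2]. *)
Lemma sqrt_decay (R : realType) (c delta s : R) :
  0 < c -> 0 <= delta -> delta * c ^+ 2 <= 1 -> 1 <= s ->
  c * s `^ (- (1 / 2)) * (1 - delta * (c * s `^ (- (1 / 2))) ^+ 2) <=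
  c * (s + 2 * delta * c ^+ 2) `^ (- (1 / 2)).
Proof.
move=> c0 d0 dc s1.
have s0 : 0 < s by exact: lt_le_trans s1.
have powE (x : R) : 0 <= x -> x `^ (- (1 / 2)) = (Num.sqrt x)^-1.
  by move=> x0; rewrite powRN -powR12_sqrt// div1r.
have dc0 : 0 <= delta * c ^+ 2 by rewrite mulr_ge0// sqr_ge0.
have sd0 : 0 < s + 2 * delta * c ^+ 2 by rewrite ltr_wpDr// -mulrA mulr_ge0.
rewrite (powE _ (ltW s0)) (powE _ (ltW sd0)) -mulrA ler_pM2l//.
rewrite exprMn exprVn (sqr_sqrtr (ltW s0)) -[X in _ <= X]mul1r.
rewrite ler_pdivlMr ?sqrtr_gt0// -[X in X <= _]mulrA.
rewrite ler_pdivrMl ?sqrtr_gt0// mulr1.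
set u := delta * (c ^+ 2 / s).
have us : u * s = delta * c ^+ 2 by rewrite /u; field; rewrite gt_eqF.
have u0 : 0 <= u by rewrite mulr_ge0// divr_ge0 ?sqr_ge0// ltW.
have u1 : u <= 1.
  by rewrite -(ler_pM2r s0) us mul1r (le_trans dc).
have -> : s + 2 * delta * c ^+ 2 = s * (1 + 2 * u).
  by rewrite -(mulrA 2) -us; ring.
rewrite (sqrtrM _ (ltW s0)) mulrCA ler_piMr ?sqrtr_ge0//.
rewrite -(@ler_pXn2r _ 2)// ?nnegrE ?mulr_ge0 ?sqrtr_ge0 ?subr_ge0//.
rewrite exprMn sqr_sqrtr; last lra.
by rewrite expr1n; nra.
Qed.

(** Compare [1 + (y - x) <= e^(y - x)] with [(1 + d) / (1 - d) = 1 + 2 d / (1 - d)]. *)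
Lemma ln_gap_le (R : realType) (d x y : R) : 0 <= d -> d < 1 ->
  (1 - d) * expR (- x) <= (1 + d) * expR (- y) -> y - x <= 2 * d / (1 - d).
Proof.
move=> d0 d1 h; have d1' : 0 < 1 - d by rewrite subr_gt0.
have E : expR (y - x) <= (1 + d) / (1 - d).
  have yy : (1 + d) * (expR y * expR (- y)) = 1 + d by rewrite -expRD subrr expR0 mulr1.
  rewrite ler_pdivlMr// expRD.
  by have := ler_wpM2l (expR_ge0 y) h; lra.
have := le_trans (expR_ge1Dx _) E; rewrite -lerBrDl => /le_trans; apply.
by rewrite le_eqVlt; apply/orP; left; apply/eqP; field; rewrite gt_eqF.
Qed.

Fixpoint iter_renorm (R : realType) (theta : R) (b N : nat) (p : {poly R}) (k : nat) :=
  if k is k'.+1 then renorm_poly theta b (iter k' (muln b) N) (iter_renorm theta b N p k')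
  else p.

Definition fourier_truncation (R : realType) (a : int -> R) (N : nat) : {poly R} :=
  \poly_(j < N.*2.+1) a (j%:Z - N%:Z).

(** [delta] solves [4 * delta * (1 + c ^ 2) = theta ^ 2], so both smallness conditions of
    [ratio_le_renorm] hold for [c] and for every smaller ratio met later; [sqrt_decay] is the
    induction step. Nothing in the bound depends on [N]. *)
Lemma iter_renorm_invariant (R : realType) (theta c : R) (b N k : nat) (p : {poly R}) :
  (2 <= b)%N -> b%:R * theta = 1 -> 0 < c ->
  (forall i, 0 <= p`_i) -> palindromic p N -> 0 < p`_N -> ratio_le p N c ->
  let delta := theta ^+ 2 / (4 * (1 + c ^+ 2)) in
  let q := iter_renorm theta b N p k in let M := iter k (muln b) N in
  [/\ forall i, 0 <= q`_i, palindromic q M, 0 < q`_M &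
      ratio_le q M (c * (1 + 2 * delta * c ^+ 2 * k%:R) `^ (- (1 / 2)))].
Proof.
move=> b2 bt c0 p0 pp pN pc delta /=.
have b0 : 0 < b%:R :> R by rewrite ltr0n; lia.
have b2R : 2 <= b%:R :> R by rewrite ler_nat.
have t0 : 0 < theta by rewrite -(pmulr_rgt0 _ b0) bt ltr01.
have t12 : theta <= 1 / 2 by have := ler_wpM2r (ltW t0) b2R; lra.
have tt : theta ^+ 2 <= 1 / 4 by nra.
have c20 : 0 <= c ^+ 2 by exact: sqr_ge0.
have dE : delta * (4 * (1 + c ^+ 2)) = theta ^+ 2 by rewrite divfK// gt_eqF//; lra.
have d0 : 0 <= delta by rewrite divr_ge0 ?sqr_ge0//; lra.
have dc0 : 0 <= delta * c ^+ 2 by rewrite mulr_ge0.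
elim: k => [|k [q0 pq qM qc]] /=.
  by split=> // n; rewrite mulr0 addr0 powR1 mulr1.
set x := c * _ `^ _ in qc.
have g0 : 0 <= 2 * delta * c ^+ 2 by lra.
have s1 : 1 <= 1 + 2 * delta * c ^+ 2 * k%:R by rewrite lerDl mulr_ge0.
have x0 : 0 <= x by rewrite mulr_ge0 ?powR_ge0// ltW.
have xc : x <= c.
  have s0 := lt_le_trans ltr01 s1.
  rewrite /x ler_piMr ?(ltW c0)// powRN invf_le1 ?powR_gt0//.
  by rewrite div1r powR12_sqrt ?(ltW s0)// -[X in X <= _]sqrtr1 ler_wsqrtr.
split.
- exact: renorm_poly_ge0 (ltW t0) q0.
- exact: palindromic_renorm.
- rewrite -[X in _`_X]addn0 coef_renorm_poly// expr0 mul1r addn0.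
  exact: coefX_center_gt0.
- move=> n.
  have xc2 : x ^+ 2 <= c ^+ 2 by rewrite ler_sqr ?nnegrE// ltW.
  have := ler_wpM2l d0 xc2 => dxc.
  have := @ratio_le_renorm _ theta b _ _ x delta b2 bt x0 d0 _ _ q0 pq qc n.
  move=> /(_ ltac:(lra) ltac:(lra)) /le_trans; apply; apply: ler_wpM2r.
    exact: renorm_poly_ge0 (ltW t0) q0 _.
  rewrite -[k.+1%:R]natr1 [2 * delta * c ^+ 2 * _]mulrDr mulr1 addrA.
  by apply: sqrt_decay => //; lra.
Qed.

Lemma palindromic_truncation (R : realType) (a : int -> R) (N : nat) :
  (forall n, a (- n) = a n) -> palindromic (fourier_truncation a N) N.
Proof.
move=> ae; split; first exact: size_poly.
move=> i iN; rewrite !coef_poly !ltnS leq_subr iN -ae; congr a; lia.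
Qed.

Lemma trig_eval_truncation (R : realType) (a : int -> R) (N : nat) (z : R) :
  trig_eval (fourier_truncation a N) N z = cos_partial_sum a z N.
Proof.
apply: eq_bigr => i _; rewrite coef_poly ltn_ord.
by rewrite intrB.
Qed.

Lemma ratio_le_truncation (R : realType) (a : int -> R) (N : nat) (c : R) :
  (forall n, 0 <= a n) -> 0 <= c -> (forall n : nat, a n.+1 <= c * a n) ->
  ratio_le (fourier_truncation a N) N c.
Proof.
move=> a0 c0 ac n; rewrite !coef_poly; case: ifPn => [h|_]; last first.
  by rewrite mulr_ge0//; case: ifP.
rewrite (ltnW h).
have -> : ((N + n).+1 : int) - N%:Z = n.+1 by lia.
by have -> : (N + n)%N%:Z - N%:Z = n by lia.
Qed.

(* Both quantities are within a factor [1 +- d] of the constant coefficient of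
   [p ^+ b], which the renormalization does not change. *)
Lemma trig_eval_renorm_close (R : realType) (theta eps : R) (b M : nat)
    (p : {poly R}) (z z' : R) :
  0 <= theta -> theta <= 1 -> 0 <= eps -> b%:R * eps <= 1 / 8 ->
  (forall i, 0 <= p`_i) -> palindromic p M -> ratio_le p M eps ->
  let d := 16 / 7 * (b%:R * eps) in
  let X := trig_eval (renorm_poly theta b M p) (b * M) z in
  let Y := trig_eval p M z' ^+ b in
  (1 - d) * X <= (1 + d) * Y /\ (1 - d) * Y <= (1 + d) * X.
Proof.
move=> t0 t1 e0 e8 p0 pp pe d X Y.
set A := (p ^+ b)`_(b * M).
have be0 : 0 <= b%:R * eps by rewrite mulr_ge0.
have pb0 := coefX_ge0 b p0.
have A0 : 0 <= A by exact: pb0.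
have Ale n : (p ^+ b)`_(b * M + n) <= (b%:R * eps) ^+ n * A.
  elim: n => [|n IH]; first by rewrite addn0 expr0 mul1r.
  rewrite addnS (le_trans (ratio_leX b p0 e0 pe n))//.
  by rewrite exprS -[leRHS]mulrA ler_wpM2l.
have YA : `|Y - A| <= d * A.
  rewrite /Y -trig_evalX//.
  by apply: trig_eval_center_le => //; exact: palindromicX.
have cX : (renorm_poly theta b M p)`_(b * M) = A.
  by rewrite -[X in _`_X]addn0 coef_renorm_poly// expr0 mul1r addn0.
have XA : `|X - A| <= d * A.
  rewrite /X -cX; apply: trig_eval_center_le => //.
  - exact: renorm_poly_ge0.
  - exact: palindromic_renorm.
  - move=> n; rewrite coef_renorm_poly// cX (le_trans _ (Ale n))// ler_piMl//.
    exact: exprn_ile1.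
move: XA YA; rewrite !ler_norml => /andP[X1 X2] /andP[Y1 Y2].
have d0 : 0 <= d by rewrite mulr_ge0//; lra.
have d1 : d <= 1 by rewrite /d; lra.
have h (u w : R) : A - d * A <= w -> u <= A + d * A -> (1 - d) * u <= (1 + d) * w.
  move=> wA uA; apply: (@le_trans _ _ ((1 - d) * ((1 + d) * A))).
    by apply: ler_wpM2l; lra.
  by rewrite mulrCA; apply: ler_wpM2l; lra.
by split; apply: h; lra.
Qed.

(** A zero integral would force [f] to vanish almost everywhere, and the whole space would be
    null. *)
Lemma integral_probability_gt0 (d : measure_display) (T : measurableType d)
    (R : realType) (P : probability T R) (f : T -> R) :
  measurable_fun setT f -> (forall w, 0 < f w) -> (0 < \int[P]_w (f w)%:E)%E.
Proof.
move=> mf f0; rewrite lt_def; apply/andP; split; last first.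
  by apply: integral_ge0 => w _; rewrite lee_fin ltW.
apply/negP => /eqP intf0.
have mEf : measurable_fun setT (EFin \o f) by exact/measurable_EFinP.
have [+ _] := ae_eq_integral_abs P measurableT mEf.
have -> : (\int[P]_w `|(EFin \o f) w| = 0)%E.
  by rewrite -intf0; apply: eq_integral => w _; rewrite /= ger0_norm ?ltW.
move=> /(_ erefl) [A [mA A0 sA]].
have : P setT = 0%E.
  apply: (subset_measure0 _ mA) => // w _.
  by apply: sA => /= /(_ I) [] /eqP; rewrite gt_eqF.
by rewrite probability_setT => /eqP; rewrite eqe oner_eq0.
Qed.

(** Induction on [k]. The bound uniform in [N] and [z] is carried along because its power [B ^ b]
    dominates the integrands of the next expectation. *)
Lemma iter_renorm_cvg (d : measure_display) (T : measurableType d)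
    (R : realType) (P : probability T R) (zeta : {RV P >-> R}) (beta theta : R)
    (b : nat) (v0 : R -> R) (a0 : int -> R) (k : nat) :
  0 < beta -> centered_normal zeta beta -> theta = expR (- (2 * pi ^+ 2 / beta)) ->
  (forall z, v0 (- z) = v0 z) -> fourier_repr v0 a0 ->
  let u N := trig_eval (iter_renorm theta b N (fourier_truncation a0 N) k)
                       (iter k (muln b) N) in
  (forall z, u N z @[N --> \oo] --> expR (- renorm_potential zeta b v0 k z)) /\
  exists B, forall N z, `|u N z| <= B.
Proof.
move=> beta0 hz tE ve va /=.
have t0 : 0 <= theta by rewrite tE expR_ge0.
have t1 : theta <= 1.
  by rewrite tE -expR0 ler_expR oppr_le0 divr_ge0 ?(ltW beta0)// mulr_ge0// sqr_ge0.
have a0E := fourier_repr_even ve va.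
have a0_ge0 n : 0 <= a0 n by have [+ _ _] := va; move=> /(_ n)/ltW.
have tr0 N i : 0 <= (fourier_truncation a0 N)`_i by rewrite coef_poly; case: ifP.
have ptr N := palindromic_truncation N a0E.
pose q k N := iter_renorm theta b N (fourier_truncation a0 N) k.
pose M k N := iter k (muln b) N.
have q0 j N i : 0 <= (q j N)`_i.
  by elim: j i => [|j IH] i; [exact: tr0|exact: renorm_poly_ge0].
have pq j N : palindromic (q j N) (M j N).
  by elim: j => [|j IH]; [exact: ptr|exact: palindromic_renorm].
rewrite -/(q k _); elim: k => [|k [IHc [B uB]]].
  split=> [z|].
    rewrite (_ : (fun N => _) = cos_partial_sum a0 z); first exact: (fourier_repr_cvg z va).1.
    by apply/funext => N; exact: trig_eval_truncation.
  have [B aB] := fourier_repr_le va; exists B => N z.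
  apply: le_trans (trig_eval_norm_le _ _ (tr0 N)) _; apply: le_trans (aB N).
  by rewrite trig_eval_truncation; apply: ler_sum => j _; rewrite mulr0 cos0 mulr1.
have B0 : 0 <= B := le_trans (normr_ge0 _) (uB 0%N 0).
split=> [z|]; last first.
  exists (B ^+ b) => N z.
  apply: le_trans (trig_eval_renorm_le _ _ t0 t1 (q0 k N) (pq k N)) _.
  apply: le_trans (ler_norm _) _; rewrite normrX.
  by apply: lerXn2r; rewrite ?nnegrE ?normr_ge0// uB.
pose F y := expR (- renorm_potential zeta b v0 k y).
(* The potential is measurable only as seen through [F], a pointwise limit of trigonometric
   polynomials. *)
have mF : measurable_fun [set: R] F.
  apply: (measurable_fun_cvg (h := fun N => trig_eval (q k N) (M k N))) => [N|y _].
    exact: measurable_trig_eval.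
  exact: IHc.
have mz : measurable_fun setT (fun w => z + zeta w) by exact: measurable_funD.
have [|||||fint _ fcvg] := @dominated_convergence _ _ _ P setT measurableT
    (fun N => EFin \o (fun w => trig_eval (q k N) (M k N) (z + zeta w) ^+ b))
    (EFin \o (fun w => F (z + zeta w) ^+ b)) (cst (B ^+ b)%:E).
- move=> N; apply/measurable_EFinP; apply: measurable_funX.
  exact: (measurableT_comp (measurable_trig_eval _ _) mz).
- apply/measurable_EFinP; apply: measurable_funX.
  exact: (measurableT_comp mF mz).
- apply: aeW => w _; apply: cvg_EFin; first exact: nearW.
  exact: (cvg_comp _ (fun x : R => x ^+ b) (IHc _) (@exprn_continuous _ b _)).
- exact: finite_measure_integrable_cst.
- apply: aeW => w N _; rewrite /= lee_fin normrX.
  by apply: lerXn2r; rewrite ?nnegrE ?normr_ge0// uB.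
pose E := (\int[P]_w (F (z + zeta w) ^+ b)%:E)%E.
have Efin : E \is a fin_num by exact: integrable_fin_num fint.
have E0 : (0 < E)%E.
  apply: integral_probability_gt0 => [|w]; last by rewrite exprn_gt0 ?expR_gt0.
  by apply: measurable_funX; exact: (measurableT_comp mF mz).
(* Since [E] is finite and positive, neither [fine] nor [ln] takes a default value and [expR] undoes
   [ln]. *)
have -> : expR (- renorm_potential zeta b v0 k.+1 z) = fine E.
  rewrite /= opprK.
  rewrite (_ : 'E_P[_] = E)%E; first by rewrite lnK// posrE fine_gt0// E0 ltey_eq Efin.
  rewrite unlock; apply: eq_integral => w _.
  by rewrite /F -expRM_natl mulrN.
move: fcvg; rewrite -/E -(fineK Efin).
rewrite (_ : [sequence _]_n = fun N => (trig_eval (q k.+1 N) (M k.+1 N) z)%:E).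
  by move=> /fine_cvg.
by apply/funext => N /=; apply: expectation_trig_eval beta0 hz tE (pq k N).
Qed.

Theorem theorem3p5 (R : realType) (b : nat) (hb : (2 <= b)%N)
  (beta : R) (hbeta : 0 < beta)
  (theta : R) (theta_def : theta = expR (- (2 * pi ^+ 2 / beta)))
  (hbtheta : b%:R * theta = 1)
  (v0 : R -> R) (hv0 : calV v0)
  (a0 : int -> R) (ha0 : fourier_repr v0 a0)
  (c0 : R) (c0_def : c0 = fine (sup_ratio a0))
  (d : measure_display) (T : measurableType d) (P : probability T R)
  (zeta : {RV P >-> R}) (hzeta : centered_normal zeta beta)
  (v : nat -> R -> R) (v_def : v = renorm_potential zeta b v0) :
  exists2 gamma : R, 0 < gamma &
    forall k : nat,
      (1 + gamma * k%:R) `^ (- (1 / 2)) * b%:R * c0 <= 1 / 8 ->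
      (ereal_sup [set (`|v k.+1 zz.1 - b%:R * v k zz.2|)%:E
                  | zz in `[0%R, 1%R] `*` `[0%R, 1%R]]
       <= (8 * (1 + gamma * k%:R) `^ (- (1 / 2)) * b%:R * c0)%:E)%E.
Proof.
have va := ha0; have [a0_gt0 _ _] := ha0.
have [ve [a va' supa]] := hv0.
(* The finite supremum now concerns [a0] itself, so [c0] is a true supremum and not a default value
   of [fine]. *)
rewrite (fourier_repr_inj va' va) in supa.
have sup_fin : sup_ratio a0 \is a fin_num.
  rewrite fin_numE; apply/andP; split; last by rewrite lt_eqF.
  rewrite gt_eqF//; apply: lt_le_trans (ltNyr (a0 1%N / a0 0%N)) _.
  by apply: ereal_sup_ubound; exists 0%N.
have ac0 (n : nat) : a0 n.+1 <= c0 * a0 n.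
  rewrite -ler_pdivrMr// -lee_fin c0_def fineK//.
  by apply: ereal_sup_ubound; exists n.
have c00 : 0 < c0.
  have := lt_le_trans (a0_gt0 1%N) (ac0 0%N).
  by rewrite pmulr_lgt0.
have a0_ge0 n : 0 <= a0 n by exact: ltW.
have a0E := fourier_repr_even ve va.
have t0 : 0 <= theta by rewrite theta_def expR_ge0.
have b0 : 0 < b%:R :> R by rewrite ltr0n; lia.
have tgt0 : 0 < theta by rewrite -(pmulr_rgt0 _ b0) hbtheta ltr01.
have t1 : theta <= 1.
  have b1 : 1 <= b%:R :> R by rewrite ler1n; lia.
  by have := ler_wpM2r t0 b1; rewrite hbtheta mul1r.
pose delta := theta ^+ 2 / (4 * (1 + c0 ^+ 2)).
have c20 : 0 < c0 ^+ 2 by rewrite exprn_gt0.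
have d0 : 0 < delta by rewrite divr_gt0 ?exprn_gt0//; lra.
(* This is the increment of [s] in [sqrt_decay]; the ratio at stage [k] is then at most
   [eps = c0 * x]. *)
exists (2 * delta * c0 ^+ 2); first by rewrite mulr_gt0// mulr_gt0.
move=> k hk; set x := (1 + _) `^ _ in hk *.
have x0 : 0 <= x by exact: powR_ge0.
pose eps := c0 * x.
have eps0 : 0 <= eps by rewrite mulr_ge0// ltW.
have beps : b%:R * eps = x * b%:R * c0 by rewrite /eps; ring.
apply: ge_ereal_sup => _ [[z z'] _ <-] /=; rewrite lee_fin.
have [cvg1 _] := iter_renorm_cvg b k.+1 hbeta hzeta theta_def ve va.
have [cvg0 _] := iter_renorm_cvg b k hbeta hzeta theta_def ve va.
rewrite -v_def in cvg0 cvg1.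
pose q k N := iter_renorm theta b N (fourier_truncation a0 N) k.
pose M k N := iter k (muln b) N.
pose d' := 16 / 7 * (b%:R * eps).
pose X N := trig_eval (q k.+1 N) (M k.+1 N) z.
pose Y N := trig_eval (q k N) (M k N) z' ^+ b.
(* Non-strict inequalities with the same [d'] for all [N], so they pass to the limit. *)
have XY N : (1 - d') * X N <= (1 + d') * Y N /\ (1 - d') * Y N <= (1 + d') * X N.
  have tr0 i : 0 <= (fourier_truncation a0 N)`_i by rewrite coef_poly; case: ifP.
  have trN : 0 < (fourier_truncation a0 N)`_N.
    by rewrite coef_poly -addnn ltnS leq_addr.
  have [q0 pq _ qc] := iter_renorm_invariant k hb hbtheta c00 tr0
    (palindromic_truncation N a0E) trN (ratio_le_truncation N a0_ge0 (ltW c00) ac0).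
  by apply: trig_eval_renorm_close => //; rewrite beps.
have Xc : X N @[N --> \oo] --> expR (- v k.+1 z) by exact: cvg1.
have Yc : Y N @[N --> \oo] --> expR (- (b%:R * v k z')).
  rewrite -mulrN expRM_natl.
  exact: (cvg_comp _ (fun x : R => x ^+ b) (cvg0 z') (@exprn_continuous _ b _)).
have be0 : 0 <= b%:R * eps by rewrite mulr_ge0.
have d'0 : 0 <= d' by rewrite /d'; lra.
have d'1 : d' <= 2 / 7 by rewrite /d' beps; lra.
have lim_le (U W : nat -> R) (l l' : R) : (forall N, (1 - d') * U N <= (1 + d') * W N) ->
    U N @[N --> \oo] --> l -> W N @[N --> \oo] --> l' -> (1 - d') * l <= (1 + d') * l'.
  move=> UW Ul Wl; rewrite -subr_ge0.
  have WUl : (1 + d') * W N - (1 - d') * U N @[N --> \oo] -->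
    (1 + d') * l' - (1 - d') * l by apply: cvgB; apply: cvgMr.
  apply: (cvgr_to_ge WUl).
  by apply: nearW => N /=; rewrite subr_ge0.
(* Since [d' <= 2 / 7], the left side is at most [14 / 5 * d' = 32 / 5 * (x * b * c0)], and
   [32 / 5 <= 8]. *)
have gap : 2 * d' / (1 - d') <= 8 * x * b%:R * c0.
  rewrite ler_pdivrMr; last lra.
  have e0 : 0 <= x * b%:R * c0 by rewrite -beps mulr_ge0.
  have d'E : d' = 16 / 7 * (x * b%:R * c0) by rewrite /d' beps.
  have := ler_wpM2l e0 d'1; move: (d') d'E => D DE; lra.
rewrite ler_norml; apply/andP; split.
- rewrite lerNl opprB; apply: le_trans gap; apply: ln_gap_le => //; first lra.
  by apply: lim_le Xc Yc => N; case: (XY N).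
- apply: le_trans gap; apply: ln_gap_le => //; first lra.
  by apply: lim_le Yc Xc => N; case: (XY N).
Qed.
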